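(* Let ${\cal H}_B,{\cal H}_C$ have dimensions $d_B\le d_C$. Let $(\varphi_i,M_i)_{i=1}^N$ consist of pure states $\ket{\varphi_i}\in{\cal H}_B\otimes{\cal H}_C$ with $E(\varphi_i)\ge\log d_B-\Delta_i$ ($\Delta_i\ge0$) for all $i$, and a POVM $(M_i)_{i=1}^N$ of PPT operators with $\tr(\varphi_iM_i)\ge1-\epsilon$ for all $i$. Then for every $\gamma>1/(1-\epsilon)^2$, $$N\le\Bigl(1-\epsilon-\sqrt{1/\gamma}\Bigr)^{-1}\Bigl(\frac1N\sum_{i=1}^N2^{-\gamma(\Delta_i+1)}\Bigr)^{-1}d_C\le\Bigl(1-\epsilon-\sqrt{1/\gamma}\Bigr)^{-1}2^{\sum_{i=1}^N\gamma(\Delta_i+1)/N}\,d_C.$$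
   Context: Logarithms are base 2. $E(\varphi)=S(\tr_C\varphi)$ for pure $\varphi$. An operator $M$ on ${\cal H}_B\otimes{\cal H}_C$ is PPT if its partial transpose $M^\Gamma$ (with respect to a fixed product basis: $\ket{ij}\bra{kl}\mapsto\ket{il}\bra{kj}$) is positive semidefinite. *)

(* Defs.v *)
From HB Require Import structures.
From mathcomp Require Import all_boot all_order all_algebra.
From mathcomp Require Import spectral.
From mathcomp Require Import all_classical all_reals.
From mathcomp Require Import exp.
From mathcomp Require Import complex.
Set Implicit Arguments. Unset Strict Implicit. Unset Printing Implicit Defensive.
Import Order.TTheory GRing.Theory Num.Theory.
Local Open Scope ring_scope.

Section QDefs.
Variable R : realType.
Local Notation C := R[i].

Definition log2 (x : R) : R := ln x / ln 2.

Definition cR (x : R) : C := Complex x 0.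

Definition adjmx m n (A : 'M[C]_(m, n)) : 'M[C]_(n, m) := (map_mx Num.conj A)^T.

(* positive semidefinite: <v, M v> >= 0 for all v (order of the numeric
   field R[i]: 0 <= z means z is real and nonnegative) *)
Definition psd n (M : 'M[C]_n) : Prop :=
  forall v : 'cV[C]_n, 0 <= (adjmx v *m M *m v) 0 0.

(* product basis of H_B (x) H_C : |i j> is basis vector tidx i j *)
Definition tidx dB dC (i : 'I_dB) (j : 'I_dC) : 'I_(dB * dC) := mxvec_index i j.

Definition ptrans dB dC (M : 'M[C]_(dB * dC)) : 'M[C]_(dB * dC) :=
  \sum_(i < dB) \sum_(j < dC) \sum_(k < dB) \sum_(l < dC)
     M (tidx i j) (tidx k l) *: delta_mx (tidx i l) (tidx k j).

Definition PPT dB dC (M : 'M[C]_(dB * dC)) : Prop := psd (ptrans M).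

Definition ptraceC dB dC (M : 'M[C]_(dB * dC)) : 'M[C]_dB :=
  \matrix_(i < dB, k < dB) \sum_(j < dC) M (tidx i j) (tidx k j).

Definition xlogx (x : R) : R := if x == 0 then 0 else x * log2 x.

(* von Neumann entropy S(rho) = - sum over eigenvalues of  lambda log lambda;
   eigenvalues (with multiplicity) are the diagonal of the spectral
   decomposition of the (normal) matrix rho *)
Definition vN_entropy n (rho : 'M[C]_n) : R :=
  - \sum_(i < n) xlogx (complex.Re (spectral_diag rho 0 i)).

Definition proj_op n (phi : 'cV[C]_n) : 'M[C]_n := phi *m adjmx phi.

Definition ent_E dB dC (phi : 'cV[C]_(dB * dC)) : R :=
  vN_entropy (ptraceC (proj_op phi)).

Definition pure_state n (phi : 'cV[C]_n) : Prop := (adjmx phi *m phi) 0 0 = 1.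

Definition POVM n N (M : 'I_N -> 'M[C]_n) : Prop :=
  (forall i, psd (M i)) /\ \sum_(i < N) M i = 1%:M.

End QDefs.

(* Main.v *)
Require Import Defs.
From HB Require Import structures.
From mathcomp Require Import all_boot all_order all_algebra.
From mathcomp Require Import spectral.
From mathcomp Require Import all_classical all_reals.
From mathcomp Require Import sequences exp.
From mathcomp Require Import complex.
From mathcomp Require Import ring lra.
Set Implicit Arguments. Unset Strict Implicit. Unset Printing Implicit Defensive.
Import Order.TTheory GRing.Theory Num.Theory.
Local Open Scope ring_scope.

(** It suffices to bound each trace from below,
    [tr M_i >= d_B 2^(-gamma (Delta_i + 1)) (1 - eps - 1/sqrt gamma)],
    since the traces sum to [d_B d_C]; the second inequality is Jensen's.
    Damp the Schmidt coefficients of [phi_i] by a filter on [B], writing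
    [phi_i = b + w] where the squared Schmidt coefficients of [b] are at most
    [k 2^(gamma (Delta_i + 1)) / d_B] and [|w|^2 <= (1 - k) / sqrt gamma] for
    some [0 < k < 1]. Then
    [<phi_i|M|phi_i> <= <b|M|b> / k + <w|M|w> / (1 - k)], where the last term is
    at most [1/sqrt gamma] because [M <= 1], and the PPT condition bounds
    [<b|M|b>] by [tr M] times the largest squared Schmidt coefficient of [b].
    A sharp cutoff of the coefficients does not give this for all [gamma]: the
    filter decays smoothly above a threshold that depends on
    [gamma (Delta_i + 1)]. *)

(** * Truncation of a spectrum by its entropy *)

(** [1 + x <= expR x] at [x = 1 / 16], raised to the 16th power. Together with [ln2_ge], obtained
    likewise with 32 factors, it yields the margin [17 / 25 - 19 / 50 = 3 / 10]. *)
Lemma expRN1_le (R : realType) : expR (- 1) <= 19 / 50 :> R.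
Proof.
have -> : (-1 : R) = 16%:R * (- 16%:R^-1) by field.
rewrite expRM_natl expRN.
have h : (17 / 16)  <= expR (16%:R^-1) :> R.
  by apply: le_trans (expR_ge1Dx _); lra.
have h2 : (17 / 16) ^+ 16 <= expR (16%:R^-1) ^+ 16 :> R.
  by apply: lerXn2r => //; rewrite nnegrE; [lra|exact: expR_ge0].
rewrite exprVn invf_ple ?posrE; [|by rewrite exprn_gt0 ?expR_gt0|lra].
by apply: le_trans h2; lra.
Qed.

Lemma expRN2_le (R : realType) : expR (- 2) <= 3 / 20 :> R.
Proof.
have -> : (-2 : R) = -1 + -1 by lra.
rewrite expRD; have := expRN1_le R; have := expR_ge0 (-1 : R).
by move=> *; nra.
Qed.

Lemma ln2_ge (R : realType) : 17 / 25 <= ln 2 :> R.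
Proof.
rewrite -ler_expR lnK ?posrE//.
rewrite -[leLHS]invrK -expRN invf_ple ?posrE ?expR_gt0//.
have -> : (- (17 / 25) : R) = 32%:R * (- (17 / 800)) by field.
rewrite expRM_natl.
have h : (783 / 800)  <= expR (- (17 / 800)) :> R.
  by apply: le_trans (expR_ge1Dx _); lra.
have h2 : (783 / 800) ^+ 32 <= expR (- (17 / 800)) ^+ 32 :> R.
  by apply: lerXn2r => //; rewrite nnegrE; [lra|exact: expR_ge0].
by apply: le_trans h2; lra.
Qed.

Lemma xlnx_ge (R : realType) (x : R) : 0 < x -> - expR (- 1) <= x * ln x.
Proof.
move=> x0; have := expR_ge1Dx (- ln x - 1).
rewrite expRD expRN lnK ?posrE// => h.
have := ler_wpM2l (ltW x0) h.
rewrite mulrA mulfV ?gt_eqF// mul1r; lra.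
Qed.

(** Convexity by hand: the chord joins 1 at [t = 0] to [3 / 20] at [t = 2]. The tangent bounds of
    [expR t] at 0 and at 2 give [h0] and [h1], which are combined with weights [1 - t / 2] and
    [t / 2]. *)
Lemma expRN_chord (R : realType) (t : R) : 0 <= t <= 2 ->
  expR (- t) <= 1 - 17 / 40 * t.
Proof.
move=> /andP[t0 t2].
have h0 : expR (- t) * (1 + t) <= 1.
  by rewrite expRN mulrC ler_pdivrMr ?expR_gt0// mul1r expR_ge1Dx.
have h1 : expR (- t) * (t - 1) <= 3 / 20.
  apply: le_trans (expRN2_le R).
  have -> : (-2 : R) = - t + (t - 2) by lra.
  rewrite expRD ler_wpM2l ?expR_ge0//.
  by apply: le_trans (expR_ge1Dx _); lra.
have h2 : (1 - t / 2) * (expR (- t) * (1 + t)) <= 1 - t / 2.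
  by rewrite -[leRHS]mulr1 ler_wpM2l//; lra.
have h3 : t / 2 * (expR (- t) * (t - 1)) <= t / 2 * (3 / 20).
  by rewrite ler_wpM2l//; lra.
have -> : expR (- t) = (1 - t / 2) * (expR (- t) * (1 + t)) +
   t / 2 * (expR (- t) * (t - 1)) by field.
lra.
Qed.

(* The filter keeps logarithmic levels up to [s] and damps level [s + u] by
   [expR (- (u / 2))]; [tau] is the level of the final bound and [expR (s - tau)]
   becomes the constant [k]. The weight removed by the filter is linear in the
   level, with slope [Q^-1]. The margin [3 / 10] is a lower bound for
   [ln 2 - expR (- 1)]. For large [tau] the threshold lies [ln (tau / (3 / 10))]
   below [tau]. *)
Lemma truncation_parameters (R : realType) (tau r : R) :
  0 < tau -> 0 < r <= 1 -> exists s Q : R, [/\ 0 <= s < tau, 0 < Q,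
    forall u, 0 <= u -> (1 - expR (- (u / 2))) ^+ 2 * Q <= s + u &
    r ^+ 2 * tau - 3 / 10 <= r * (1 - expR (s - tau)) * Q].
Proof.
move=> tau0 /andP[r0 r1].
have r21 : r ^+ 2 <= r by rewrite expr2 ler_piMr// ltW.
have [tau2|tau2] := lerP tau 2.
  (* For small [tau] the threshold is 0. The chord bound leaves [17 / 20 * (r * tau)] on the right,
     short of [r * tau] by at most [3 / 10] because [tau <= 2]. *)
  exists 0, 2; split => //; first by rewrite lexx.
    move=> u u0; have := expR_ge1Dx (- (u / 2)).
    have : expR (- (u / 2)) <= 1 by rewrite expR_le1; lra.
    have := expR_ge0 (- (u / 2)); set z := expR _ => z0 z1 zu.
    nra.
  rewrite sub0r.
  have h := @expRN_chord R tau; have {}h := h ltac:(by rewrite (ltW tau0)).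
  have : r * expR (- tau) <= r * (1 - 17 / 40 * tau) by rewrite ler_pM2l.
  have : r ^+ 2 * tau <= r * tau by rewrite ler_pM2r.
  nra.
have q0 : 0 < tau / (3 / 10) by apply: divr_gt0; lra.
have e2 : tau / (3 / 10) <= expR tau.
  have -> : tau = 2 + (tau - 2) by lra.
  rewrite expRD.
  have a1 : 20 / 3 <= expR 2 :> R.
    have := expRN2_le R; rewrite expRN => h.
    by rewrite -[leRHS]invrK -[leLHS]invrK lef_pV2 ?posrE ?invr_gt0 ?expR_gt0 //; lra.
  have a2 : 1 + (tau - 2) <= expR (tau - 2) by exact: expR_ge1Dx.
  apply: le_trans (_ : 20 / 3 * (1 + (tau - 2)) <= _); first lra.
  by apply: ler_pM => //; lra.
(* With this [c], [expR (- c) * tau] equals [3 / 10]: the loss caused by [expR (s - tau)] stays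
   within the margin. *)
set c := ln (tau / (3 / 10)).
have ec : expR c = tau / (3 / 10) by rewrite lnK.
have ctau : c <= tau by rewrite -ler_expR ec.
have c0 : 0 < c by rewrite -expR_gt1 ec; lra.
exists (tau - c), tau; split => //.
- by apply/andP; split; lra.
- move=> u u0; set z := expR _.
  have z0 : 0 < z by exact: expR_gt0.
  have z1 : z <= 1 by rewrite /z expR_le1; lra.
  have [cu|uc] := lerP c u.
    have : (1 - z) ^+ 2 <= 1 by nra.
    move=> h; have : (1 - z) ^+ 2 * tau <= tau by rewrite ger_pMl.
    lra.
  (* This is the filter bound without the harmless term [tau * z * (1 - z)]. The factor
     [2 <= tau * expR (1 - c / 2)] becomes [4 <= 3 / 10 * tau * expR 2] when squared, which follows
     from [2 < tau] and [20 / 3 <= expR 2]. *)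
  have key : c - u <= tau * z.
    have -> : z = expR ((c - u) / 2 - 1) * expR (1 - c / 2).
      by rewrite -expRD; congr expR; lra.
    have a1 : (c - u) / 2 <= expR ((c - u) / 2 - 1).
      by apply: le_trans (expR_ge1Dx _); lra.
    have a2 : 2 <= tau * expR (1 - c / 2).
      rewrite -(@ler_pXn2r _ 2%N)// ?nnegrE; [|lra|by rewrite mulr_ge0 ?expR_ge0 ?ltW].
      rewrite exprMn -expRM_natl.
      have -> : 2%:R * (1 - c / 2) = - (c + -2) by field.
      rewrite expRN expRD ec; have := expRN2_le R; have := expR_gt0 (-2 : R).
      set e := expR _ => e0 e3.
      have -> : tau ^+ 2 / (tau / (3 / 10) * e) = tau * (3 / 10) / e.
        by field; rewrite !gt_eqF.
      by rewrite ler_pdivlMr//; nra.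
    rewrite mulrCA [leLHS](_ : _ = (c - u) / 2 * 2); last by field.
    by apply: ler_pM => //; lra.
  have -> : (1 - z) ^+ 2 * tau = tau - tau * z - tau * z * (1 - z) by ring.
  have : 0 <= tau * z * (1 - z) by rewrite !mulr_ge0// ?subr_ge0// ltW.
  lra.
- have -> : tau - c - tau = - c by ring.
  rewrite expRN ec.
  have -> : r * (1 - (tau / (3 / 10))^-1) * tau = r * tau - r * (3 / 10).
    by field; rewrite gt_eqF.
  have : r ^+ 2 * tau <= r * tau by rewrite ler_pM2r.
  lra.
Qed.

Lemma powR2E (R : realType) (x : R) : 2 `^ x = expR (x * ln 2).
Proof. by rewrite /powR pnatr_eq0. Qed.

(* The negative part of [x ln x] is at most [expR (- 1)]; this is the only loss
   incurred by passing from the relative entropy to its positive part. *)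
Lemma sum_ln_ge0_le (R : realType) n (lam : 'I_n -> R) (Delta : R) :
  (forall i, 0 <= lam i) -> \sum_i lam i = 1 ->
  log2 (n%:R) - Delta <= - \sum_i xlogx (lam i) ->
  \sum_i lam i * Num.max 0 (ln (n%:R * lam i)) <= Delta * ln 2 + expR (- 1).
Proof.
move=> lam0 lam1 hH.
have n0 : (0 < n)%N.
  by case: n lam lam0 lam1 hH => // lam _; rewrite big_ord0 => /esym/eqP; rewrite oner_eq0.
have nR0 : 0 < n%:R :> R by rewrite ltr0n.
have ln20 : 0 < ln 2 :> R by have := ln2_ge R; lra.
apply: le_trans (_ : \sum_i (lam i * ln n%:R + ln 2 * xlogx (lam i) + expR (- 1) / n%:R) <= _).
  apply: ler_sum => i _.
  rewrite /xlogx; case: eqVneq => [->|li0].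
    by rewrite !mul0r mulr0 !add0r divr_ge0 ?expR_ge0 ?ltW.
  have li : 0 < lam i by rewrite lt_def li0 lam0.
  have -> : ln 2 * (lam i * log2 (lam i)) = lam i * ln (lam i).
    by rewrite /log2; field; rewrite gt_eqF.
  rewrite -mulrDr -lnM ?posrE//.
  have nl : 0 < n%:R * lam i by rewrite mulr_gt0.
  have h : - (expR (- 1) / n%:R) <= lam i * ln (n%:R * lam i).
    by rewrite lerNl ler_pdivlMr//; have := xlnx_ge nl; lra.
  have e0 : 0 <= expR (- 1) / n%:R :> R by rewrite divr_ge0 ?expR_ge0 ?ltW.
  case: (lerP 0 (ln _)) => _; [lra|rewrite mulr0; lra].
rewrite !big_split /= -mulr_suml lam1 mul1r -mulr_sumr sumr_const card_ord.
rewrite -[_ / _ *+ n]mulr_natr mulfVK ?gt_eqF// lerD2r.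
have := ler_wpM2l (ltW ln20) hH.
rewrite {1}/log2 mulrBr mulrCA mulfV ?gt_eqF// mulr1; lra.
Qed.

(** The level of [lam i] is [ln (n * lam i)], and [u i] is its excess over the threshold [s];
    damping by [expR (- (u i / 2))] caps the level at [s]. The removed weight is linear in the
    positive part of the level, whose mean is at most [Delta * ln 2 + expR (- 1)], hence at most
    [r ^+ 2 * tau - 3 / 10]. *)
Lemma entropy_truncation (R : realType) n (lam : 'I_n -> R) (Delta gamma : R) :
  (forall i, 0 <= lam i) -> \sum_i lam i = 1 -> 0 <= Delta -> 1 < gamma ->
  log2 (n%:R) - Delta <= - \sum_i xlogx (lam i) ->
  exists (k : R) (g : 'I_n -> R), [/\ 0 < k < 1,
    forall i, g i ^+ 2 * lam i <= k * (2 `^ (gamma * (Delta + 1)) / n%:R) &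
    \sum_i (1 - g i) ^+ 2 * lam i <= Num.sqrt (gamma^-1) * (1 - k)].
Proof.
move=> lam0 lam1 D0 g1 hH.
have n0 : (0 < n)%N.
  by case: n lam lam0 lam1 hH => // lam _; rewrite big_ord0 => /esym/eqP; rewrite oner_eq0.
have nR0 : 0 < n%:R :> R by rewrite ltr0n.
have ln2 := ln2_ge R.
set r := Num.sqrt _; set tau := gamma * (Delta + 1) * ln 2.
have gi0 : 0 < gamma^-1 by rewrite invr_gt0; lra.
have r2 : r ^+ 2 = gamma^-1 by rewrite sqr_sqrtr// ltW.
have r01 : 0 < r <= 1.
  rewrite sqrtr_gt0 gi0 /=.
  rewrite -(@ler_pXn2r _ 2%N)// ?nnegrE ?sqrtr_ge0// r2 expr1n invf_le1; lra.
have tau0 : 0 < tau by rewrite !mulr_gt0//; lra.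
have [s [Q [/andP[s0 stau] Q0 hu hQ]]] := truncation_parameters tau0 r01.
pose u i := Num.max 0 (ln (n%:R * lam i) - s).
have u0 i : 0 <= u i by rewrite le_max lexx.
exists (expR (s - tau)), (fun i => expR (- (u i / 2))); split.
- by rewrite expR_gt0 expR_lt1 subr_lt0.
- move=> i; rewrite powR2E -/tau mulrA -expRD subrK -expRM_natl.
  have := lam0 i; rewrite le_eqVlt => /predU1P[<-|li].
    by rewrite mulr0 divr_ge0 ?expR_ge0 ?ltW.
  have nl : 0 < n%:R * lam i by rewrite mulr_gt0.
  rewrite ler_pdivlMr// -mulrA [lam i * _]mulrC -[_ * lam i]lnK ?posrE// -expRD ler_expR.
  have : ln (n%:R * lam i) - s <= u i by rewrite le_max lexx orbT.
  have -> : 2%:R * - (u i / 2) = - u i by field.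
  lra.
- apply: le_trans (_ : \sum_i (lam i * Num.max 0 (ln (n%:R * lam i))) / Q <= _).
    apply: ler_sum => i _; rewrite mulrC -mulrA ler_wpM2l// ler_pdivlMr//.
    have [->|ui] := eqVneq (u i) 0.
      by rewrite mul0r oppr0 expR0 subrr expr0n mul0r le_max lexx.
    apply: le_trans (hu _ (u0 i)) _.
    have : u i = ln (n%:R * lam i) - s.
      by move: ui; rewrite /u; case: ltP => //; rewrite eqxx.
    by move=> ->; rewrite addrCA subrr addr0 le_max lexx orbT.
  rewrite -mulr_suml ler_pdivrMr//; apply: le_trans hQ.
  apply: le_trans (sum_ln_ge0_le lam0 lam1 hH) _.
  have -> : r ^+ 2 * tau = (Delta + 1) * ln 2.
    by rewrite r2 /tau; field; rewrite gt_eqF//; lra.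
  have := expRN1_le R; lra.
Qed.

(** Jensen by the tangent to the exponential at the mean [m]: the linear terms [(m - a i) * ln 2]
    sum to zero. *)
Lemma powR_mean_inv_le (R : realType) N (a : 'I_N -> R) : (0 < N)%N ->
  (N%:R^-1 * \sum_(i < N) (2 : R) `^ (- a i))^-1 <= 2 `^ (\sum_(i < N) a i / N%:R).
Proof.
move=> N0; have NR0 : 0 < N%:R :> R by rewrite ltr0n.
set m := (X in _ <= 2 `^ X).
have mE : m * N%:R = \sum_i a i by rewrite /m -mulr_suml mulfVK// gt_eqF.
rewrite -[leRHS]invrK lef_pV2 ?posrE ?invr_gt0 ?powR_gt0//; last first.
  rewrite mulr_gt0 ?invr_gt0//; case: N a N0 NR0 m mE => // N a _ _ _ _.
  rewrite big_ord_recl ltr_pwDl ?powR_gt0// sumr_ge0// => i _; exact: powR_ge0.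
rewrite -powRN mulrC ler_pdivlMr// mulr_natr.
apply: le_trans (_ : \sum_(i < N) 2 `^ (- m) * (1 + (m - a i) * ln 2) <= _).
  rewrite -mulr_sumr big_split /= -mulr_suml sumrB !sumr_const !card_ord.
  by rewrite -mE -[m *+ N]mulr_natr subrr mul0r addr0 mulr_natr.
apply: ler_sum => i _.
rewrite [X in _ <= _ `^ X](_ : - a i = - m + (m - a i)); last by lra.
rewrite [leRHS]powRD ?pnatr_eq0 ?implybT// ler_wpM2l ?powR_ge0// powR2E.
exact: expR_ge1Dx.
Qed.

(** * Quadratic forms and the partial transpose *)

Lemma adjmxE (R : realType) m n (A : 'M[R[i]]_(m, n)) i j :
  adjmx A i j = (A j i)^*.
Proof. by rewrite !mxE. Qed.

Lemma adjmxD (R : realType) m n (A B : 'M[R[i]]_(m, n)) :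
  adjmx (A + B) = adjmx A + adjmx B.
Proof. by apply/matrixP => i j; rewrite !mxE rmorphD. Qed.

Lemma adjmxZ (R : realType) m n (a : R[i]) (A : 'M[R[i]]_(m, n)) :
  adjmx (a *: A) = a^* *: adjmx A.
Proof. by apply/matrixP => i j; rewrite !mxE rmorphM. Qed.

Lemma adjmxM (R : realType) m n p (A : 'M[R[i]]_(m, n)) (B : 'M[R[i]]_(n, p)) :
  adjmx (A *m B) = adjmx B *m adjmx A.
Proof. by rewrite /adjmx map_mxM trmx_mul. Qed.

Lemma adjmxK (R : realType) m n : cancel (@adjmx R m n) (@adjmx R n m).
Proof. by move=> A; apply/matrixP => i j; rewrite !mxE conjCK. Qed.

Lemma adjmx_diag (R : realType) n (d : 'rV[R[i]]_n) :
  adjmx (diag_mx d) = diag_mx (map_mx Num.conj d).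
Proof.
apply/matrixP => i j; rewrite !mxE eq_sym.
by case: eqP => [->|_]; rewrite ?mulr1n ?mulr0n ?rmorph0.
Qed.

Definition qform (R : realType) n (M : 'M[R[i]]_n) (x y : 'cV[R[i]]_n) : R[i] :=
  (adjmx x *m M *m y) 0 0.

Lemma qformE (R : realType) n (M : 'M[R[i]]_n) (x y : 'cV[R[i]]_n) :
  qform M x y = \sum_i \sum_j (x i 0)^* * M i j * y j 0.
Proof.
rewrite /qform mxE exchange_big /=; apply: eq_bigr => j _.
by rewrite mxE mulr_suml; apply: eq_bigr => i _; rewrite adjmxE.
Qed.

(* Positivity at [(1 - k) x - k y]. *)
Lemma psd_qformD (R : realType) n (M : 'M[R[i]]_n) (x y : 'cV[R[i]]_n) (k : R[i]) :
  psd M -> 0 < k < 1 ->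
  qform M (x + y) (x + y) <= k^-1 * qform M x x + (1 - k)^-1 * qform M y y.
Proof.
move=> M0 /andP[k0 k1]; have k1' : 0 < 1 - k by rewrite subr_gt0.
have kNr : (- k)^* = - k by rewrite rmorphN /= geC0_conj// ltW.
have kr : (1 - k)^* = 1 - k by rewrite geC0_conj// ltW.
have := M0 ((1 - k) *: x + (- k) *: y).
rewrite /qform !adjmxD !adjmxZ kNr kr !(mulmxDl, mulmxDr) -!(scalemxAl, scalemxAr).
move: (adjmx x *m M *m x) (adjmx x *m M *m y) (adjmx y *m M *m x) (adjmx y *m M *m y).
move=> a b c d; rewrite !mxE; move: (a 0 0) (b 0 0) (c 0 0) (d 0 0) => {}a {}b {}c {}d h.
rewrite -subr_ge0.
have kk : 0 <= (k * (1 - k))^-1 by rewrite invr_ge0 mulr_ge0// ltW.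
apply: le_trans (mulr_ge0 kk h) _; rewrite le_eqVlt; apply/orP; left; apply/eqP.
by field; rewrite !gt_eqF.
Qed.

(** Positivity at [x - y]. *)
Lemma psd_qformC_le (R : realType) n (M : 'M[R[i]]_n) (x y : 'cV[R[i]]_n) :
  psd M -> qform M x y + qform M y x <= qform M x x + qform M y y.
Proof.
move=> M0; have := M0 (x + (- 1) *: y).
have e : (- 1 : R[i])^* = - 1 by rewrite rmorphN1.
rewrite /qform !adjmxD !adjmxZ e !(mulmxDl, mulmxDr) -!(scalemxAl, scalemxAr).
move: (adjmx x *m M *m x) (adjmx x *m M *m y) (adjmx y *m M *m x) (adjmx y *m M *m y).
move=> a b c d; rewrite !mxE; move: (a 0 0) (b 0 0) (c 0 0) (d 0 0) => {}a {}b {}c {}d h.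
rewrite -subr_ge0; apply: le_trans h _.
by rewrite le_eqVlt; apply/orP; left; apply/eqP; ring.
Qed.

Lemma big_tidx (V : nmodType) dB dC (F : 'I_(dB * dC) -> V) :
  \sum_p F p = \sum_(i < dB) \sum_(j < dC) F (tidx i j).
Proof.
rewrite pair_big /= (reindex (uncurry (@mxvec_index dB dC))) /=; last exact: curry_mxvec_bij.
by apply: eq_bigr => -[].
Qed.

Lemma eq_tidx dB dC (i k : 'I_dB) (j l : 'I_dC) :
  (tidx i j == tidx k l) = (i == k) && (j == l).
Proof.
apply/eqP/andP => [|[/eqP-> /eqP->]//].
(* Injectivity is tested on the vectorised matrix unit at [(i, j)]. *)
move=> /(congr1 (fun p => mxvec (delta_mx i j : 'M[int]_(dB, dC)) 0 p)).
rewrite !mxvecE !mxE !eqxx /= [k == i]eq_sym [l == j]eq_sym.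
by case: (i == k); case: (j == l).
Qed.

Lemma ptransE (R : realType) dB dC (M : 'M[R[i]]_(dB * dC)) i l k j :
  ptrans M (tidx i l) (tidx k j) = M (tidx i j) (tidx k l).
Proof.
have D (n : nat) (F : 'I_n -> R[i]) (a : 'I_n) :
    (forall b, b != a -> F b = 0) -> \sum_b F b = F a.
  by move=> h; rewrite (bigD1 a) //= big1 ?addr0.
rewrite /ptrans summxE (D _ _ i); last first.
  move=> a ai; rewrite summxE big1// => b _; rewrite summxE big1// => c _.
  rewrite summxE big1// => d _.
  by rewrite !mxE !eq_tidx [i == a]eq_sym (negPf ai) mulr0.
rewrite summxE (D _ _ j); last first.
  move=> b bj; rewrite summxE big1// => c _; rewrite summxE big1// => d _.
  by rewrite !mxE !eq_tidx [j == b]eq_sym (negPf bj) !andbF mulr0.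
rewrite summxE (D _ _ k); last first.
  move=> c ck; rewrite summxE big1// => d _.
  by rewrite !mxE !eq_tidx [k == c]eq_sym (negPf ck) !andbF mulr0.
rewrite summxE (D _ _ l); last first.
  move=> d dl.
  by rewrite !mxE !eq_tidx [l == d]eq_sym (negPf dl) !andbF mulr0.
by rewrite !mxE !eqxx mulr1.
Qed.

(** A bipartite vector is handled through its coefficient matrix [B]: its reduced state is
    [B *m adjmx B] and its Schmidt coefficients are the singular values of [B]. *)
Definition vec_of (R : realType) dB dC (B : 'M[R[i]]_(dB, dC)) : 'cV[R[i]]_(dB * dC) :=
  (mxvec B)^T.

Lemma vec_ofE (R : realType) dB dC (B : 'M[R[i]]_(dB, dC)) i j k :
  vec_of B (tidx i j) k = B i j.
Proof. by rewrite mxE (ord1 k) mxvecE. Qed.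

Lemma vec_ofD (R : realType) dB dC (A B : 'M[R[i]]_(dB, dC)) :
  vec_of (A + B) = vec_of A + vec_of B.
Proof. by rewrite /vec_of !linearD. Qed.

(** The operator [<l| N |j>] on the first factor. *)
Definition blockC (R : realType) dB dC (N : 'M[R[i]]_(dB * dC)) (l j : 'I_dC) :
  'M[R[i]]_dB := \matrix_(i, k) N (tidx i l) (tidx k j).

Lemma qform_product (R : realType) dB dC (N : 'M[R[i]]_(dB * dC))
    (a b : 'cV[R[i]]_dB) (l j : 'I_dC) :
  qform N (vec_of (a *m delta_mx 0 l)) (vec_of (b *m delta_mx 0 j)) =
  qform (blockC N l j) a b.
Proof.
rewrite !qformE big_tidx; apply: eq_bigr => i _.
rewrite (bigD1 l)//= [X in _ + X]big1 ?addr0; last first.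
  move=> l' /negPf l'l; rewrite big1// => p _.
  rewrite vec_ofE !mxE big_ord1 !mxE l'l andbF mulr0.
  by rewrite rmorph0 !mul0r.
rewrite big_tidx; apply: eq_bigr => k _.
rewrite (bigD1 j)//= [X in _ + X]big1 ?addr0; last first.
  move=> j' /negPf j'j; rewrite !vec_ofE !mxE !big_ord1 !mxE j'j andbF.
  by rewrite !mulr0.
by rewrite !vec_ofE !mxE !big_ord1 !mxE !eqxx !mulr1.
Qed.

Lemma psd_blockC (R : realType) dB dC (N : 'M[R[i]]_(dB * dC)) l :
  psd N -> psd (blockC N l l).
Proof. by move=> N0 v; rewrite -/(qform _ v v) -qform_product; exact: N0. Qed.

Lemma mxtrace_blockC (R : realType) dB dC (N : 'M[R[i]]_(dB * dC)) :
  \sum_l \tr (blockC N l l) = \tr N.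
Proof.
rewrite /mxtrace big_tidx exchange_big /=; apply: eq_bigr => i _.
by apply: eq_bigr => l _; rewrite mxE.
Qed.

Lemma mxtrace_ptrans (R : realType) dB dC (M : 'M[R[i]]_(dB * dC)) :
  \tr (ptrans M) = \tr M.
Proof.
rewrite /mxtrace !big_tidx; apply: eq_bigr => i _; apply: eq_bigr => j _.
exact: ptransE.
Qed.

(** Partial transposition swaps the labels [j] and [l] of the second factor while the columns stay
    in place, so column [j] is now paired with label [l]. *)
Lemma qform_ptrans (R : realType) dB dC (M : 'M[R[i]]_(dB * dC)) (B : 'M[R[i]]_(dB, dC)) :
  qform M (vec_of B) (vec_of B) =
  \sum_j \sum_l qform (blockC (ptrans M) l j) (col j B) (col l B).
Proof.
rewrite qformE big_tidx exchange_big /=; apply: eq_bigr => j _.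
rewrite [RHS](eq_bigr (fun l => \sum_i \sum_k
    (B i j)^* * M (tidx i j) (tidx k l) * B k l)); last first.
  move=> l _; rewrite qformE; apply: eq_bigr => i _; apply: eq_bigr => k _.
  by rewrite !mxE ptransE.
rewrite [RHS]exchange_big /=; apply: eq_bigr => i _.
rewrite big_tidx exchange_big /=; apply: eq_bigr => l _; apply: eq_bigr => k _.
by rewrite !vec_ofE.
Qed.

Lemma sum_qform_col (R : realType) m n (N : 'M[R[i]]_m) (B : 'M[R[i]]_(m, n)) :
  \sum_j qform N (col j B) (col j B) = \tr (N *m (B *m adjmx B)).
Proof.
rewrite mulmxA mxtrace_mulC /mxtrace; apply: eq_bigr => j _.
rewrite mulmxA /qform !mxE; apply: eq_bigr => i _; rewrite !mxE; congr (_ * _).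
by apply: eq_bigr => k _; rewrite !mxE.
Qed.

(* Symmetrising the sum over [j] and [l] pairs each product term with its adjoint,
   so that positivity of the partial transpose bounds it by diagonal terms. *)
Lemma qform_ptrans_le (R : realType) dB dC (M : 'M[R[i]]_(dB * dC)) (B : 'M[R[i]]_(dB, dC)) :
  PPT M -> qform M (vec_of B) (vec_of B) <=
  \sum_l \tr (blockC (ptrans M) l l *m (B *m adjmx B)).
Proof.
move=> N0; rewrite -(@ler_pM2l _ 2)// -[2]/(1 + 1) !mulrDl !mul1r.
rewrite {1}qform_ptrans qform_ptrans [X in _ + X <= _]exchange_big /=.
rewrite -!big_split /=.
rewrite [leRHS](_ : _ = \sum_j \sum_l
   (qform (blockC (ptrans M) l l) (col j B) (col j B) +
    qform (blockC (ptrans M) j j) (col l B) (col l B))).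
  apply: ler_sum => j _; rewrite -big_split /=; apply: ler_sum => l _.
  by rewrite -!qform_product; exact: psd_qformC_le.
under [RHS]eq_bigr do rewrite big_split /=.
rewrite [RHS]big_split /= [X in X + _]exchange_big /= -big_split /=.
by apply: eq_bigr => l _; rewrite sum_qform_col.
Qed.

(** * Filtering the Schmidt coefficients *)

(* Conjugating by [P] turns the trace into a nonnegative combination of the [d a]. *)
Lemma psd_mxtrace_diag_le (R : realType) n (N P : 'M[R[i]]_n) (d : 'rV[R[i]]_n) (t : R[i]) :
  psd N -> adjmx P *m P = 1%:M -> (forall a, d 0 a <= t) ->
  \tr (N *m (adjmx P *m diag_mx d *m P)) <= t * \tr N.
Proof.
move=> N0 PP dt.
have trN : \tr (P *m N *m adjmx P) = \tr N.
  by rewrite -mulmxA mxtrace_mulC -mulmxA PP mulmx1.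
rewrite -trN !mulmxA mxtrace_mulC !mulmxA /mxtrace mulr_sumr.
apply: ler_sum => a _; rewrite mul_mx_diag mxE mulrC ler_wpM2r//.
have -> : (P *m N *m adjmx P) a a = qform N (col a (adjmx P)) (col a (adjmx P)).
  rewrite /qform !mxE; apply: eq_bigr => j _; rewrite !mxE; congr (_ * _).
  by apply: eq_bigr => k _; rewrite !mxE conjCK.
exact: N0.
Qed.

Lemma PPT_qform_le (R : realType) dB dC (M : 'M[R[i]]_(dB * dC)) (B : 'M[R[i]]_(dB, dC))
    (P : 'M[R[i]]_dB) (d : 'rV[R[i]]_dB) (t : R[i]) :
  PPT M -> adjmx P *m P = 1%:M -> B *m adjmx B = adjmx P *m diag_mx d *m P ->
  (forall a, d 0 a <= t) -> qform M (vec_of B) (vec_of B) <= t * \tr M.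
Proof.
move=> M0 PP BB dt; apply: le_trans (qform_ptrans_le B M0) _.
rewrite -(mxtrace_ptrans M) -(mxtrace_blockC (ptrans M)) mulr_sumr.
apply: ler_sum => l _; rewrite BB; apply: psd_mxtrace_diag_le => //.
exact: psd_blockC.
Qed.

Lemma vec_of_norm (R : realType) dB dC (B : 'M[R[i]]_(dB, dC)) :
  (adjmx (vec_of B) *m vec_of B) 0 0 = \tr (B *m adjmx B).
Proof.
rewrite mxE /mxtrace big_tidx; apply: eq_bigr => i _; rewrite mxE.
by apply: eq_bigr => j _; rewrite adjmxE !vec_ofE !mxE mulrC.
Qed.

Lemma ptraceC_proj_vec_of (R : realType) dB dC (A : 'M[R[i]]_(dB, dC)) :
  ptraceC (proj_op (vec_of A)) = A *m adjmx A.
Proof.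
apply/matrixP => i k; rewrite !mxE; apply: eq_bigr => j _.
by rewrite mxE big_ord1 adjmxE !vec_ofE [in RHS]adjmxE.
Qed.

Lemma mxtrace_proj_op (R : realType) n (phi : 'cV[R[i]]_n) (M : 'M[R[i]]_n) :
  \tr (proj_op phi *m M) = qform M phi phi.
Proof. by rewrite -mulmxA mxtrace_mulC /mxtrace big_ord1. Qed.

Lemma vec_of_vec_mx (R : realType) dB dC (phi : 'cV[R[i]]_(dB * dC)) :
  phi = vec_of (vec_mx phi^T).
Proof. by rewrite /vec_of vec_mxK trmxK. Qed.

(** The [lam i] are the numbers that enter [vN_entropy] and also the squared Schmidt coefficients of
    [vec_of A]. They are diagonal entries of the Gram matrix of [P *m A], hence real and
    nonnegative. *)
Lemma gram_spectral (R : realType) m n (A : 'M[R[i]]_(m, n)) :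
  let rho := A *m adjmx A in
  let P := spectralmx rho in
  let lam i := complex.Re (spectral_diag rho 0 i) in
  [/\ adjmx P *m P = 1%:M, P *m adjmx P = 1%:M,
      rho = adjmx P *m diag_mx (\row_i (lam i)%:C%C) *m P & forall i, 0 <= lam i].
Proof.
move=> rho P lam.
have tC k l (X : 'M[R[i]]_(k, l)) : adjmx X = map_mx Num.conj (X^T).
  by rewrite /adjmx map_trmx.
have Pu : P \is unitarymx := spectral_unitarymx rho.
have PP : P *m adjmx P = 1%:M by rewrite tC; exact/unitarymxP.
have PP' : adjmx P *m P = 1%:M by exact: mulmx1C.
have rhoA : adjmx rho = rho by rewrite adjmxM adjmxK.
have rhon : rho \is normalmx by apply/normalmxP; rewrite -tC rhoA.
have := orthomx_spectralP rhon; rewrite -/P invmx_unitary// -tC => rhoE.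
have dE i : spectral_diag rho 0 i = (lam i)%:C%C /\ 0 <= lam i.
  have h : 0 <= spectral_diag rho 0 i.
    have : (P *m rho *m adjmx P) i i = spectral_diag rho 0 i.
      rewrite [in LHS]rhoE !mulmxA PP mul1mx -mulmxA PP mulmx1.
      by rewrite mxE eqxx mulr1n.
    move=> <-; rewrite /rho mulmxA -[P *m A *m _ *m _]mulmxA -adjmxM mxE.
    by apply: sumr_ge0 => j _; rewrite adjmxE mul_conjC_ge0.
  by split; [rewrite /lam RRe_real// ger0_real | move: h; rewrite lecE => /andP[]].
split=> // [|i]; last by case: (dE i).
rewrite {1}rhoE; congr (_ *m diag_mx _ *m _).
by apply/rowP => i; rewrite mxE; case: (dE i).
Qed.

(** The filter is diagonal in the eigenbasis of [A *m adjmx A], so filtering only rescales the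
    squared Schmidt coefficients. *)
Lemma filtered_gram (R : realType) m n (A : 'M[R[i]]_(m, n)) (P : 'M[R[i]]_m)
    (lam h : 'I_m -> R) :
  P *m adjmx P = 1%:M ->
  A *m adjmx A = adjmx P *m diag_mx (\row_i (lam i)%:C%C) *m P ->
  let B := adjmx P *m diag_mx (\row_i (h i)%:C%C) *m P *m A in
  B *m adjmx B = adjmx P *m diag_mx (\row_i (h i ^+ 2 * lam i)%:C%C) *m P.
Proof.
move=> PP AA B; rewrite /B.
have hh : map_mx Num.conj (\row_i (h i)%:C%C) = \row_i (h i)%:C%C.
  by apply/rowP => i; rewrite !mxE; exact: conjc_real.
rewrite !adjmxM adjmxK adjmx_diag hh !mulmxA.
rewrite -[_ *m A *m adjmx A]mulmxA AA !mulmxA.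
rewrite -[_ *m P *m adjmx P]mulmxA PP mulmx1.
rewrite -[_ *m P *m adjmx P]mulmxA PP mulmx1.
rewrite -2!(mulmxA (adjmx P)) !mulmx_diag; congr (_ *m diag_mx _ *m _).
by apply/rowP => i; rewrite !mxE -!rmorphM /= mulrAC expr2.
Qed.

Lemma mxtrace_unitary_diag (R : realType) n (P : 'M[R[i]]_n) (f : 'I_n -> R) :
  P *m adjmx P = 1%:M ->
  \tr (adjmx P *m diag_mx (\row_i (f i)%:C%C) *m P) = (\sum_i f i)%:C%C.
Proof.
move=> PP; rewrite mxtrace_mulC mulmxA PP mul1mx mxtrace_diag rmorph_sum.
by apply: eq_bigr => i _; rewrite mxE.
Qed.

Lemma PPT_mxtrace_ge (R : realType) dB dC (phi : 'cV[R[i]]_(dB * dC))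
    (M : 'M[R[i]]_(dB * dC)) (Delta gamma : R) :
  psd M -> psd (1%:M - M) -> PPT M -> pure_state phi -> 0 <= Delta -> 1 < gamma ->
  log2 (dB%:R) - Delta <= ent_E phi ->
  \tr (proj_op phi *m M) <=
    (2 `^ (gamma * (Delta + 1)) / dB%:R)%:C%C * \tr M + (Num.sqrt (gamma^-1))%:C%C.
Proof.
move=> M0 M1 MT phi1 D0 g1 hE.
rewrite mxtrace_proj_op; move: phi1 hE; rewrite /pure_state /ent_E (vec_of_vec_mx phi).
move: (vec_mx _) => A {phi}; rewrite vec_of_norm ptraceC_proj_vec_of => A1 hE.
have [PP' PP AA lam0] := gram_spectral A.
set P := spectralmx _ in PP PP' AA.
pose lam i := complex.Re (spectral_diag (A *m adjmx A) 0 i).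
rewrite -/lam in AA lam0.
have {}hE : log2 dB%:R - Delta <= - \sum_i xlogx (lam i) := hE.
have lam1 : \sum_i lam i = 1.
  by move: A1; rewrite AA mxtrace_unitary_diag// => -[].
have [k [g [/andP[k0 k1] gk hg]]] := entropy_truncation lam0 lam1 D0 g1 hE.
set r := Num.sqrt _ in hg *; set T := _ / _ in gk *.
pose G (f : 'I_dB -> R) := adjmx P *m diag_mx (\row_i (f i)%:C%C) *m P.
(* The filters [g] and [1 - g] sum to the identity; the two terms are the [b] and [w] of the
   decomposition. *)
have GA : A = G g *m A + G (fun i => 1 - g i) *m A.
  rewrite -mulmxDl /G -mulmxDl -mulmxDr -linearD /=.
  have -> : \row_i (g i)%:C%C + \row_i (1 - g i)%:C%C = const_mx 1 :> 'rV[R[i]]_dB.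
    by apply/rowP => i; rewrite !mxE -rmorphD /= addrC subrK.
  by rewrite diag_const_mx mulmx1 PP' mul1mx.
have kC : 0 < k%:C%C < 1 by rewrite -[1]/(1%:C)%C !ltcR k0 k1.
rewrite {1 2}GA vec_ofD.
(* The weights [k^-1] and [(1 - k)^-1] cancel the factors [k] and [1 - k] supplied by
   [entropy_truncation]. *)
apply: le_trans (psd_qformD _ _ M0 kC) _; apply: lerD.
  rewrite ler_pdivrMl//; last by case/andP: kC.
  rewrite mulrA -rmorphM /=.
  apply: (PPT_qform_le MT PP' (filtered_gram g PP AA)) => a.
  by rewrite mxE lecR.
rewrite ler_pdivrMl; last by rewrite subr_gt0; case/andP: kC.
have := M1 (vec_of (G (fun i => 1 - g i) *m A)).
rewrite mulmxBr mulmxBl mulmx1 mxE [X in _ + X]mxE subr_ge0 => h.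
apply: le_trans h _.
rewrite vec_of_norm (filtered_gram _ PP AA) mxtrace_unitary_diag//.
have -> : 1 - k%:C%C = (1 - k)%:C%C by rewrite rmorphB rmorph1.
by rewrite -rmorphM /= lecR mulrC.
Qed.

(** * Summation of the trace bounds over the POVM *)

Theorem mainTheorem6 (R : realType) (dB dC N : nat)
  (phi : 'I_N -> 'cV[R[i]]_(dB * dC)) (M : 'I_N -> 'M[R[i]]_(dB * dC))
  (Delta : 'I_N -> R) (eps gamma : R) :
  (dB <= dC)%N -> (0 < N)%N -> eps < 1 ->
  (forall i, pure_state (phi i)) ->
  (forall i, 0 <= Delta i) ->
  (forall i, log2 (dB%:R) - Delta i <= ent_E (phi i)) ->
  POVM M ->
  (forall i, PPT (M i)) ->
  (forall i, cR (1 - eps) <= \tr (proj_op (phi i) *m M i)) ->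
  (1 - eps) ^-2 < gamma ->
  N%:R <= (1 - eps - Num.sqrt (gamma^-1))^-1
          * (N%:R^-1 * \sum_(i < N) (2 : R) `^ (- (gamma * (Delta i + 1))))^-1
          * dC%:R
  /\
  (1 - eps - Num.sqrt (gamma^-1))^-1
          * (N%:R^-1 * \sum_(i < N) (2 : R) `^ (- (gamma * (Delta i + 1))))^-1
          * dC%:R
  <= (1 - eps - Num.sqrt (gamma^-1))^-1
     * (2 : R) `^ (\sum_(i < N) gamma * (Delta i + 1) / N%:R) * dC%:R.
Proof.
move=> _ N0 eps1 pure D0 hE [M0 M1] MT hM hg.
have e0 : 0 < 1 - eps by rewrite subr_gt0.
have e20 : 0 < (1 - eps) ^+ 2 by rewrite exprn_gt0.
have g0 : 0 < gamma by apply: lt_trans hg; rewrite invr_gt0.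
set r := Num.sqrt _.
have r0 : 0 < 1 - eps - r.
  rewrite subr_gt0 -(@ltr_pXn2r _ 2%N)// ?nnegrE ?sqrtr_ge0//; last exact: ltW.
  by rewrite sqr_sqrtr ?invr_ge0 ?ltW// invf_plt ?posrE.
split; last first.
  apply: ler_wpM2r => //; apply: ler_wpM2l; first by rewrite invr_ge0 ltW.
  exact: powR_mean_inv_le.
(* The complement of [M i] is the sum of the other POVM elements. *)
have M1' i : psd (1%:M - M i).
  move=> v; rewrite -M1 (bigD1 i)//= addrC addrK.
  rewrite mulmx_sumr mulmx_suml summxE; apply: sumr_ge0 => j _; exact: M0.
(* Since [M i0 <= 1], the success probability is at most 1; hence [1 - eps <= 1] and
   [(1 - eps) ^-2 >= 1]. *)
have g1 : 1 < gamma.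
  apply: le_lt_trans hg; rewrite invf_ge1//.
  have i0 := Ordinal N0.
  have := M1' i0 (phi i0); rewrite mulmxBr mulmxBl mulmx1 mxE [X in _ + X]mxE subr_ge0.
  rewrite (pure i0) -/(qform _ _ _) -mxtrace_proj_op => /(le_trans (hM i0)).
  by rewrite lecE /= => /andP[_ h]; rewrite expr_le1// ltW.
(* For [dB = 0] the state would be an empty vector, of norm 0 instead of 1. *)
have dB0 : (0 < dB)%N.
  have i0 := Ordinal N0; have := pure i0; rewrite /pure_state.
  case: (posnP dB) => // dB0.
  rewrite mxE big1 => [/eqP|p _]; first by rewrite eq_sym oner_eq0.
  by have := ltn_ord p; rewrite {2}dB0.
have dBR : 0 < dB%:R :> R by rewrite ltr0n.
have trM i : (1 - eps - r) * (dB%:R * 2 `^ (- (gamma * (Delta i + 1)))) <=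
    complex.Re (\tr (M i)).
  have := le_trans (hM i) (PPT_mxtrace_ge (M0 i) (M1' i) (MT i) (pure i) (D0 i) g1 (hE i)).
  rewrite -/r; case: (\tr (M i)) => a b /=.
  set T := _ / _; rewrite /cR lecE /= => /andP[_].
  rewrite mul0r subr0 => h.
  have TE : T * (dB%:R * 2 `^ (- (gamma * (Delta i + 1)))) = 1.
    by rewrite powRN /T; field; rewrite !gt_eqF// powR_gt0.
  have dT : 0 <= dB%:R * 2 `^ (- (gamma * (Delta i + 1))) :> R.
    by rewrite mulr_ge0 ?powR_ge0// ltW.
  have : 1 - eps - r <= T * a by lra.
  move=> /(ler_wpM2r dT); rewrite mulrAC TE mul1r; exact.
have sumM : \sum_i complex.Re (\tr (M i)) = dB%:R * dC%:R.
  have : \sum_i \tr (M i) = (dB * dC)%:R by rewrite -raddf_sum /= M1 mxtrace1.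
  move=> /(congr1 (@complex.Re R)); rewrite (big_morph (@complex.Re R) (id1 := 0) (op1 := +%R)) //; last by case=> ? ? [].
  by move=> ->; rewrite -(rmorph_nat (real_complex R)) natrM.
set S := \sum_(i < N) _.
have S0 : 0 < S.
  rewrite /S; case: N N0 {phi M pure hE M0 M1 MT hM M1' trM sumM S} Delta D0 => // n _ Delta _.
  rewrite big_ord_recl ltr_pwDl ?powR_gt0// sumr_ge0// => i _; exact: powR_ge0.
have NR0 : 0 < N%:R :> R by rewrite ltr0n.
have key : (1 - eps - r) * S <= dC%:R.
  rewrite -(ler_pM2l dBR) -sumM mulrCA /S !mulr_sumr; apply: ler_sum => i _.
  exact: trM.
have -> : (1 - eps - r)^-1 * (N%:R^-1 * S)^-1 * dC%:R = N%:R * (dC%:R / ((1 - eps - r) * S)).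
  by field; rewrite !gt_eqF.
by rewrite ler_peMr ?(ltW NR0)// ler_pdivlMr ?mul1r// mulr_gt0.
Qed.
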